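(* Let $C_n$ be the number of binary words of length $n$ (words in $\{0,1\}^*$ of length $n$) that are $\frac{7}{3}^+$-power-free. Then $C_n = \Omega(\gamma^n)$ as $n\to\infty$, where $\gamma = 2^{1/63} \doteq 1.011$.
   Context: For a word $w$, $|w|$ denotes its length. A word $v$ is a factor of a word $x$ if $x = uvw$ for some (possibly empty) words $u,w$. For a rational number $\beta \geq 1$, a nonempty word $w$ is a $\beta$-power if there exist a nonempty word $y$, a prefix $y'$ of $y$, and an integer $n \ge 0$ such that $w = y^n y'$ and $n + |y'|/|y| = \beta$. A word avoids $\alpha^+$-powers (is $\alpha^+$-power-free) if it contains no factor that is a $\beta$-power for any rational $\beta > \alpha$. The notation $C_n=\Omega(\gamma^n)$ means there is a constant $c>0$ such that $C_n \ge c\,\gamma^n$ for all sufficiently large $n$. *)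

(* Defs.v *)
From HB Require Import structures.
From mathcomp Require Import all_boot all_order all_algebra.
From mathcomp Require Import boolp reals exp.

Set Implicit Arguments.
Unset Strict Implicit.
Unset Printing Implicit Defensive.

Import Order.TTheory GRing.Theory Num.Theory.
Local Open Scope ring_scope.

Definition frac_power (T : eqType) (beta : rat) (w : seq T) : Prop :=
  [/\ 1 <= beta, w != [::] &
      exists (y y' : seq T) (n : nat),
        [/\ y != [::], prefix y' y, w = flatten (nseq n y) ++ y' &
            n%:R + (size y')%:R / (size y)%:R = beta]].

Definition plus_power_free (T : eqType) (alpha : rat) (x : seq T) : Prop :=
  forall (w : seq T) (beta : rat),
    infix w x -> alpha < beta -> ~ frac_power beta w.

Definition num_binary_plus_power_free (alpha : rat) (n : nat) : nat :=
  #|[pred x : n.-tuple bool | `[< plus_power_free alpha x >]]|.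

(* Main.v *)
Require Import Defs.
From HB Require Import structures.
From mathcomp Require Import all_boot all_order all_algebra.
From mathcomp Require Import boolp reals exp.
From mathcomp Require Import zify lra.

Set Implicit Arguments.
Unset Strict Implicit.
Unset Printing Implicit Defensive.

Import Order.TTheory GRing.Theory Num.Theory.

(** A word contains a power of exponent larger than 7/3 and period [p] exactly
when it agrees with its shift by [p] on more than [4p/3] consecutive positions;
[run] records such an agreement, and all the combinatorics is about runs.

Start from an infinite squarefree word over three letters [0, 1, 2].  Each
occurrence of [0] may be replaced by a fourth letter [3] or left alone,
independently of the others, and the result is mapped to a binary word by the
21-uniform morphism [block].  Whatever the choices, the image contains no power
of exponent larger than 7/3 ([block_image_no_run]):
- the code is synchronizing: a block occurs in the image of two letters that
  differ modulo 3 only at a block boundary.  A run that covers a complete block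
  thus has a period divisible by 21 ([block_run_period]); a period above 29
  forces the run to cover one, since then it has length at least 41 = 2 * 21 - 1;
- if [p = 21 q] with [q >= 3], the run has more than [28 q] positions, hence
  covers [q] consecutive complete blocks, as [28 q + 1 >= 21 q + 20]; decoding
  them gives a square of period [q] in the ternary word ([no_run_long_period]);
- the remaining periods, 1 to 29 and 42, concern windows of at most six blocks,
  and finitely many such windows exist ([no_run_short_period]).

The words so obtained are distinct for distinct choices, so a prefix made of [m]
blocks gives [2 ^ z] words, where [z] is the number of occurrences of [0] among
the first [m] letters.  Shifting the three letters cyclically makes [0] the most
frequent of them, so that [z >= m / 3].  With [m = n / 21] this is [2 ^ (n / 63)]
up to a constant factor.

The ternary squarefree word is the sequence of differences of consecutive letters
of the Thue-Morse word: the sum of the differences over a period of a square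
vanishes, so that a square of differences comes from an overlap in the
Thue-Morse word ([tm_diff_squarefree]), and there is none
([thue_morse_overlap_free]). *)

(** * Runs of agreement with a shift *)

Definition run {T : Type} (x : nat -> T) (p i k : nat) : Prop :=
  forall j, j < k -> x (i + j) = x (i + j + p).

Definition squarefree {T : Type} (x : nat -> T) : Prop :=
  forall p i, 0 < p -> ~ run x p i p.

(** * The Thue-Morse word and a squarefree ternary word *)

(** Parity of the binary digit sum of [n]; as halving is not structural, the
recursion is on a bound for the number of digits. *)
Fixpoint digit_parity (fuel n : nat) : bool :=
  if fuel is fuel'.+1 then odd n (+) digit_parity fuel' n./2 else false.

Definition thue_morse (n : nat) : bool := digit_parity n n.

Lemma digit_parity0 k : digit_parity k 0 = false.
Proof. by elim: k. Qed.

Lemma digit_parity_fuel k l n :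
  n <= k -> n <= l -> digit_parity k n = digit_parity l n.
Proof.
elim: k l n => [|k IH] l [|n] hk hl; rewrite ?digit_parity0 //.
by case: l hl => // l hl /=; congr addb; apply: IH; lia.
Qed.

Lemma thue_morseE n : thue_morse n = odd n (+) thue_morse n./2.
Proof.
case: n => // n; rewrite {1}/thue_morse [digit_parity _ _]/=; congr addb.
apply: digit_parity_fuel; lia.
Qed.

Lemma thue_morse_double n : thue_morse n.*2 = thue_morse n.
Proof. by rewrite thue_morseE odd_double doubleK. Qed.

Lemma thue_morse_doubleS n : thue_morse n.*2.+1 = ~~ thue_morse n.
Proof. by rewrite thue_morseE /= odd_double uphalf_double. Qed.

Lemma thue_morse_even_succ n : ~~ odd n -> thue_morse n.+1 = ~~ thue_morse n.
Proof.
move=> ev; have -> : n = n./2.*2 by lia.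
by rewrite thue_morse_doubleS thue_morse_double.
Qed.

(** Among three consecutive indices one finds a pair [2 m], [2 m + 1]. *)
Lemma thue_morse_no_cube n :
  ~ (thue_morse n = thue_morse n.+1 /\ thue_morse n.+1 = thue_morse n.+2).
Proof.
case=> e1 e2; case: (boolP (odd n)) => on.
  have := @thue_morse_even_succ n.+1; rewrite /= negbK -e2 => /(_ on).
  by case: (thue_morse _).
by have := thue_morse_even_succ on; rewrite -e1; case: (thue_morse _).
Qed.

(** An alternating stretch that starts at an odd index [2 m + 1] gives
[t (m + 1) = t (2 m + 2) = ~~ t (2 m + 1) = t m], and the same one step further;
five alternating letters contain such a stretch of length four and would
therefore come from a cube. *)
Lemma thue_morse_no_alternation n :
  ~ (forall j, j < 4 -> thue_morse (n + j).+1 = ~~ thue_morse (n + j)).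
Proof.
have odd_case m : ~ (forall j, j < 3 ->
    thue_morse (m.*2.+1 + j).+1 = ~~ thue_morse (m.*2.+1 + j)).
  move=> alt; apply: (@thue_morse_no_cube m).
  have h0 := alt 0 isT; have h2 := alt 2 isT.
  rewrite addn0 thue_morse_doubleS negbK -doubleS thue_morse_double in h0.
  rewrite addn2 -[m.*2.+3]/(m.+1.*2.+1) thue_morse_doubleS negbK -doubleS
          thue_morse_double in h2.
  by rewrite h2 h0.
move=> alt; case: (boolP (odd n)) => on.
  apply: (odd_case n./2) => j hj.
  have -> : n./2.*2.+1 = n by lia.
  by apply: alt; lia.
apply: (odd_case n./2) => j hj.
have -> : n./2.*2.+1 + j = n + j.+1 by lia.
by apply: alt; lia.
Qed.

(** Overlaps of even period descend to overlaps of half the period.  When the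
period is odd, one of the indices [j] and [j + p] is even, and an even index is
followed by the opposite letter; agreement of the two copies transfers this to
both, so the whole overlap alternates, which is impossible.  Period 1 is apart:
its overlap has only three letters, and is a cube. *)
Lemma thue_morse_overlap_free p i : 0 < p -> ~ run thue_morse p i p.+1.
Proof.
elim/ltn_ind: p i => p IH i p0 ov; case: (boolP (odd p)) => op; last first.
  apply: (IH p./2 _ i./2) => [||j hj]; [lia | lia |].
  have [j' hj' e] : exists2 j', j' < p.+1 & (i + j')./2 = i./2 + j.
    by exists (j.*2 - odd i); lia.
  have := ov j' hj'; rewrite !(thue_morseE (i + j' + p)) (thue_morseE (i + j')).
  have -> : (i + j' + p)./2 = i./2 + j + p./2 by lia.
  have -> : odd (i + j' + p) = odd (i + j') by lia.
  by rewrite e => /addbI.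
have alt j : j < p -> thue_morse (i + j).+1 = ~~ thue_morse (i + j).
  move=> hj; case: (boolP (odd (i + j))) => oj; last exact: thue_morse_even_succ.
  have h1 := ov j (ltnW _); have h2 := ov j.+1 hj.
  rewrite h1 ?ltnS // -addnS h2 ?addnS ?addSn.
  by apply: thue_morse_even_succ; rewrite oddD oj op.
have [p1|p3] : p = 1 \/ 3 <= p by lia.
  have h0 := ov 0; have h1 := ov 1; rewrite p1 !addn0 !addn1 in h0 h1.
  by apply: (@thue_morse_no_cube i); split; [apply: h0 | apply: h1].
apply: (@thue_morse_no_alternation i) => j hj.
have [hjp|hjp] := ltnP j p; first exact: alt.
have -> : i + j = i + (j - p) + p by lia.
have h1 := ov (j - p); have h2 := ov (j - p).+1.
rewrite -h1; last lia.
have -> : (i + (j - p) + p).+1 = i + (j - p).+1 + p by lia.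
rewrite -h2; last lia.
by rewrite addnS; apply: alt; lia.
Qed.

(** The difference of consecutive letters, plus one so as to stay in [nat]. *)
Definition tm_diff (n : nat) : nat := thue_morse n.+1 + 1 - thue_morse n.

Lemma tm_diff_lt3 n : tm_diff n < 3.
Proof. by rewrite /tm_diff; do 2 case: (thue_morse _). Qed.

(** Equal differences over two consecutive periods make the letters at [i],
[i + p] and [i + 2 p] an arithmetic progression; with values 0 and 1 it must be
constant, and then the two periods agree letter by letter, with one more letter
after the second. *)
Lemma tm_diff_squarefree : squarefree tm_diff.
Proof.
move=> p i p0 sq; apply: (@thue_morse_overlap_free p i p0).
have step j : j <= p ->
  thue_morse (i + j) + thue_morse (i + p) = thue_morse (i + j + p) + thue_morse i.
  (* telescoping of the differences from [i] to [i + j] *)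
  elim: j => [|j IHj] hj; first by rewrite addn0 addnC.
  have := sq j hj; have := IHj (ltnW hj); rewrite /tm_diff (addnS i) addSn.
  by do 6 case: (thue_morse _).
have e : thue_morse (i + p) = thue_morse i.
  by have := step p (leqnn p); do 3 case: (thue_morse _).
by move=> j hj; have := step j hj; rewrite e; do 3 case: (thue_morse _).
Qed.

(** * The binary images and their runs *)

(** The letters 0 and 3 have images that differ only in the middle position, and
so do 1 and 2; the images of 3 and 2 are the complements of those of 1 and 0. *)
Definition block (a : nat) : seq bool :=
  nth [::] [seq [seq odd d | d <- s] | s <-
    [:: [:: 0;1;1;0;1;0;0;1;1;0;0;1;0;0;1;1;0;1;0;0;1];
        [:: 1;0;0;1;0;1;1;0;0;1;0;0;1;1;0;0;1;0;1;1;0];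
        [:: 1;0;0;1;0;1;1;0;0;1;1;0;1;1;0;0;1;0;1;1;0];
        [:: 0;1;1;0;1;0;0;1;1;0;1;1;0;0;1;1;0;1;0;0;1] ] ] a.

Definition block_image (w : nat -> nat) (n : nat) : bool :=
  nth false (block (w (n %/ 21))) (n %% 21).

Lemma size_block a : a < 4 -> size (block a) = 21.
Proof. by case: a => [|[|[|[|]]]]. Qed.

Lemma block_inj a b : a < 4 -> b < 4 -> block a = block b -> a = b.
Proof. by case: a => [|[|[|[|]]]] //; case: b => [|[|[|[|]]]]. Qed.

Lemma nth_block_image w m j :
  j < 21 -> block_image w (21 * m + j) = nth false (block (w m)) j.
Proof.
move=> hj.
by rewrite /block_image mulnC divnMDl // divn_small // addn0 modnMDl modn_small.
Qed.

(** Reduces a statement on a bounded part of the infinite image to one on an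
explicit finite word. *)
Lemma block_image_window w m k j :
  (forall i, w i < 4) -> j < 21 * k ->
  block_image w (21 * m + j) =
    nth false (flatten [seq block (w i) | i <- iota m k]) j.
Proof.
move=> w4; elim: k m j => [|k IH] m j hj /=; first by rewrite muln0 in hj.
rewrite nth_cat size_block //; case: ltnP => h21; first exact: nth_block_image.
have -> : 21 * m + j = 21 * m.+1 + (j - 21) by lia.
by apply: IH; lia.
Qed.

Lemma block_image_letter_inj w w' m m' :
  (forall i, w i < 4) -> (forall i, w' i < 4) ->
  (forall j, j < 21 -> block_image w (21 * m + j) = block_image w' (21 * m' + j)) ->
  w m = w' m'.
Proof.
move=> w4 w4' h; apply: block_inj => //.
apply: (@eq_from_nth _ false); rewrite !size_block // => j hj.
by rewrite -!nth_block_image // h.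
Qed.

(** The ternary letter behind a letter [a < 4] is [a %% 3], so that 3 is a copy of
0; in a squarefree word adjacent letters [b], [c] are different modulo 3. *)
Definition synchronizing : bool :=
  all (fun a => all (fun b => all (fun c =>
    (b == c %[mod 3]) ||
    all (fun r => take 21 (drop r (block b ++ block c)) != block a) (iota 1 20))
  (iota 0 4)) (iota 0 4)) (iota 0 4).

Lemma synchronizing_true : synchronizing.
Proof. by vm_compute. Qed.

(** Otherwise the block at [m] would occur, at an offset [p %% 21] that is not 0,
inside the image of the letters [m + p %/ 21] and its successor. *)
Lemma block_run_period w m p :
  (forall i, w i < 4) -> squarefree (fun i => w i %% 3) ->
  run (block_image w) p (21 * m) 21 -> 21 %| p.
Proof.
move=> w4 sf eqb; rewrite /dvdn; apply/negPn/negP => r0.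
set m' := m + p %/ 21; set r := p %% 21 in r0.
have r21 : r < 21 by rewrite ltn_mod.
have I4 i : w i \in iota 0 4 by rewrite mem_iota w4.
have := synchronizing_true => /allP /(_ _ (I4 m)) /allP /(_ _ (I4 m')) /allP.
move=> /(_ _ (I4 m'.+1)) /orP[/eqP e|].
  by apply: (@sf 1 m' isT) => -[|//] _; rewrite addn0 addn1.
move=> /allP /(_ r) /implyP; rewrite mem_iota.
have -> : (1 <= r < 1 + 20) by lia.
move=> /eqP; apply; apply: (@eq_from_nth _ false).
  by rewrite size_takel ?size_drop ?size_cat !size_block //; lia.
rewrite size_takel ?size_drop ?size_cat ?size_block //; last lia.
move=> j hj; rewrite nth_take // nth_drop -nth_block_image // eqb //.
have -> : 21 * m + j + p = 21 * m' + (r + j).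
  by rewrite /m' /r {1}(divn_eq p 21); lia.
by rewrite (@block_image_window _ _ 2) //= ?cats0 //; lia.
Qed.

(** Nested conditionals instead of conjunctions let evaluation by value stop at the
first mismatch, which keeps the exhaustive computation below small. *)
Fixpoint starts_run (k : nat) (s : seq bool) : bool :=
  if k is k'.+1 then
    if s is b :: s' then if b then starts_run k' s' else false else false
  else true.

Fixpoint has_run (k : nat) (s : seq bool) : bool :=
  if starts_run k s then true
  else if s is _ :: s' then has_run k s' else false.

Definition agreements (p : nat) (u : seq bool) : seq bool :=
  [seq z.1 == z.2 | z <- zip u (drop p u)].

Definition square_free_upto (q : nat) (s : seq nat) : bool :=
  all (fun q => all (fun i => take q (drop i s) != take q (drop (i + q) s))
                    (iota 0 (size s - q.*2).+1)) (iota 1 q).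

Fixpoint words (n : nat) : seq (seq nat) :=
  if n is n'.+1 then [seq a :: s | a <- iota 0 4, s <- words n'] else [:: [::]].

(** The periods that synchronization leaves open: those whose run may be too short
to cover a block, and [42 = 2 * 21], whose run need not cover two blocks. *)
Definition short_periods : seq nat := 42 :: iota 1 29.

(** Six blocks suffice: a run of period at most 42, together with its shift, spans
at most [57 + 42 = 99] positions, and it starts at one of the first 21 positions
of the window of [6 * 21 = 126]. *)
Definition short_images : seq (seq bool) :=
  [seq flatten (map block s)
    | s <- words 6 & square_free_upto 3 (map (modn^~ 3) s)].

Definition no_short_runs : bool :=
  all (fun u => all (fun p => ~~ has_run ((4 * p) %/ 3).+1 (agreements p u))
                    short_periods) short_images.

Lemma no_short_runs_true : no_short_runs.
Proof. by vm_compute. Qed.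

(** The default [false] makes the hypothesis force [k <= size s]. *)
Lemma starts_runP k s : (forall j, j < k -> nth false s j) -> starts_run k s.
Proof.
elim: k s => // k IH [|b s] h /=; first by have := h 0 isT.
by have /= -> := h 0 isT; apply: IH => j hj; apply: (h j.+1).
Qed.

Lemma has_run_drop k s i : starts_run k (drop i s) -> has_run k s.
Proof.
elim: s i => [|b s IH] [|i] //= h; rewrite ?h //.
by rewrite (IH i h) if_same.
Qed.

Lemma nth_agreements p u j :
  j + p < size u -> nth false (agreements p u) j = (nth false u j == nth false u (j + p)).
Proof.
move=> hj; have hz : j < size (zip u (drop p u)) by rewrite size_zip size_drop; lia.
by rewrite (nth_map (false, false)) // nth_zip_cond hz /= nth_drop addnC.
Qed.

Lemma mem_words w m k :
  (forall i, w i < 4) -> [seq w i | i <- iota m k] \in words k.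
Proof.
move=> w4; elim: k m => // k IH m.
have wm : w m \in iota 0 4 by rewrite mem_iota w4.
exact: (allpairs_f cons wm (IH m.+1)).
Qed.

Lemma square_free_upto_factor (t : nat -> nat) m k q :
  squarefree t -> q.*2 <= k -> square_free_upto q [seq t i | i <- iota m k].
Proof.
move=> sf qk; apply/allP => p; rewrite mem_iota => hp.
apply/allP => i; rewrite mem_iota size_map size_iota => hi.
apply/eqP; rewrite -!map_drop -!map_take !drop_iota !take_iota.
have -> : minn p (k - i) = p by lia.
have -> : minn p (k - (i + p)) = p by lia.
move=> e; apply: (sf p (m + i)); first lia.
move=> j hj; have := congr1 (fun s => nth 0 s j) e.
rewrite !(nth_map 0) ?size_iota // !nth_iota // => ->.
by congr t; lia.
Qed.

Lemma no_run_short_period w p i k :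
  (forall i, w i < 4) -> squarefree (fun i => w i %% 3) ->
  p \in short_periods -> 4 * p < 3 * k -> ~ run (block_image w) p i k.
Proof.
move=> w4 sf hp hk rn.
have p42 : p <= 42 by move: hp; rewrite inE mem_iota; lia.
set m := i %/ 21; set r := i %% 21.
have ei : i = 21 * m + r by rewrite /m /r {1}(divn_eq i 21); lia.
have r21 : r < 21 by rewrite ltn_mod.
set s := [seq w i | i <- iota m 6]; set u := flatten (map block s).
have su : size u = 126 by rewrite /u /s /= !size_cat !size_block.
have hu : u \in short_images.
  apply: (map_f (fun s => flatten (map block s))).
  rewrite mem_filter mem_words // -map_comp andbT.
  exact: (@square_free_upto_factor (fun i => w i %% 3)).
have := no_short_runs_true => /allP /(_ u hu) /allP /(_ _ hp) /negP.
apply; apply: (@has_run_drop _ _ r).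
apply: starts_runP => j hj; rewrite nth_drop nth_agreements; last by rewrite su; lia.
have win l : l < 126 -> nth false u l = block_image w (21 * m + l).
  by move=> hl; rewrite (@block_image_window _ _ 6) // /u /s -map_comp.
rewrite !win; [|lia|lia]; apply/eqP.
by have := rn j; rewrite ei !addnA => ->; lia.
Qed.

(** The period is a multiple [21 q] of the block length because the run covers a
block; then [q >= 3], which makes the run cover [q] blocks in a row and yields a
square upstairs. *)
Lemma no_run_long_period w p i k :
  (forall i, w i < 4) -> squarefree (fun i => w i %% 3) ->
  29 < p -> p != 42 -> 4 * p < 3 * k -> ~ run (block_image w) p i k.
Proof.
move=> w4 sf p29 p42 hk rn; set m := (i + 20) %/ 21.
(* [m] is the first block that starts inside the run *)
have hm : i <= 21 * m <= i + 20 by rewrite /m; lia.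
have shift l : i <= l < i + k -> block_image w l = block_image w (l + p).
  move=> hl; have := rn (l - i); have -> : i + (l - i) = l by lia.
  by apply; lia.
have /dvdnP[q ep] : 21 %| p.
  by apply: (@block_run_period w m) => // j hj; apply: shift; lia.
apply: (@sf q m); first lia.
move=> j hj; congr (_ %% 3); apply: block_image_letter_inj => // l hl.
by rewrite shift; [congr block_image; lia | lia].
Qed.

Lemma block_image_no_run w p i k :
  (forall i, w i < 4) -> squarefree (fun i => w i %% 3) ->
  0 < p -> 4 * p < 3 * k -> ~ run (block_image w) p i k.
Proof.
move=> w4 sf p0; case hp: (p \in short_periods).
  exact: no_run_short_period.
by move: hp; rewrite inE mem_iota => hp; apply: no_run_long_period => //; lia.
Qed.

(** * From runs to fractional powers *)

Lemma nth_flatten_nseq (T : Type) (x0 : T) (y : seq T) n j :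
  j < n * size y -> nth x0 (flatten (nseq n y)) j = nth x0 y (j %% size y).
Proof.
elim: n j => //= n IH j hj; rewrite nth_cat.
case: ltnP => h; first by rewrite modn_small.
rewrite IH; first by rewrite -[in RHS](subnK h) modnDr.
by move: hj; rewrite mulSn; lia.
Qed.

Local Open Scope ring_scope.

(** A factor [y ^ m y'] agrees with its shift by [size y], on a run shorter than
the factor by [size y]. *)
Lemma plus_power_free_of_no_run (x : nat -> bool) (n : nat) :
  (forall p i k, (0 < p)%N -> (4 * p < 3 * k)%N -> ~ run x p i k) ->
  plus_power_free (7 / 3) (mkseq x n).
Proof.
move=> nr w beta /infixP[u [v euv]] hb [_ _ [y [y' [m [y0 /prefixP[z ey] ew eb]]]]].
have p0 : (0 < size y)%N by rewrite lt0n size_eq0.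
have sw : size w = (m * size y + size y')%N.
  by rewrite ew size_cat size_flatten /shape map_nseq sumn_nseq mulnC.
have hlen : (7 * size y < 3 * size w)%N.
  have p0' : 0 < (size y)%:R :> rat by rewrite ltr0n.
  move: hb; rewrite -eb sw -(ltr_pM2r p0') [ltRHS]mulrDl divfK ?gt_eqF // => hb.
  by rewrite -(ltr_nat rat) !natrM natrD natrM; lra.
have per j : (j + size y < size w)%N ->
    nth false w j = nth false w (j + size y)%N.
  have nthw l : (l < size w)%N -> nth false w l = nth false y (l %% size y)%N.
    move=> hl; rewrite -(@nth_flatten_nseq _ _ _ m.+1).
      have -> : flatten (nseq m.+1 y) = w ++ z.
        by rewrite -addn1 nseqD flatten_cat /= cats0 ew -catA -ey.
      by rewrite nth_cat hl.
    apply: (leq_trans hl); rewrite sw mulSn addnC leq_add2r ey size_cat.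
    exact: leq_addr.
  by move=> hj; rewrite !nthw ?modnDr //; lia.
apply: (nr (size y) (size u) (size w - size y)%N) => //; first lia.
have xw j : (j < size w)%N -> x (size u + j)%N = nth false w j.
  move=> hj; have := congr1 size euv; rewrite size_mkseq !size_cat => sn.
  rewrite -(@nth_mkseq _ false x n); last lia.
  by rewrite euv nth_cat ltnNge leq_addr /= addKn nth_cat hj.
move=> j hj; have hjw : (j + size y < size w)%N by lia.
have jw : (j < size w)%N by lia.
by rewrite -addnA (xw _ jw) (xw _ hjw) per.
Qed.

(** * Counting the images *)

Local Close Scope ring_scope.

Lemma squarefree_shift (t : nat -> nat) c :
  (forall i, t i < 3) -> squarefree t -> squarefree (fun i => (t i + c) %% 3).
Proof.
move=> t3 sf p i p0 rn; apply: (sf p i p0) => j hj.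
have /eqP := rn j hj; rewrite eqn_modDr => /eqP.
by rewrite !modn_small.
Qed.

(** The three cyclic relabellings of the letters of [tm_diff] have [m] zeros in
total among the first [m] letters, so one of them has at least a third. *)
Lemma squarefree_many_zeros m :
  exists t : nat -> nat, [/\ forall i, t i < 3, squarefree t &
    m <= 3 * #|[set i : 'I_m | t i == 0]|].
Proof.
pose t c i := (tm_diff i + c) %% 3.
pose z c := #|[set i : 'I_m | t c i == 0]|.
have tot : m = z 0 + z 1 + z 2.
  rewrite -{1}(card_ord m) -sum1_card /z -!sum1_card.
  rewrite !(big_mkcond (fun i => i \in _)) /= -!big_split /=.
  apply: eq_bigr => i _; rewrite !inE /t.
  by have := tm_diff_lt3 i; case: (tm_diff i) => [|[|[|]]].
have [c hc] : exists c, m <= 3 * z c.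
  have [h|h] := leqP m (3 * z 0); first by exists 0.
  have [h'|h'] := leqP m (3 * z 1); first by exists 1.
  by exists 2; lia.
exists (t c); split=> // [i|]; first by rewrite ltn_mod.
by apply: squarefree_shift; [exact: tm_diff_lt3 | exact: tm_diff_squarefree].
Qed.

(** Distinguishes the zeros selected by [c] by writing them as the letter 3. *)
Definition recolour (t : nat -> nat) (c : pred nat) (i : nat) : nat :=
  if (t i == 0) && c i then 3 else t i.

(** The [2 ^ z] words come from the subsets of the [z] zeros among the first
[n %/ 21] letters; the subset can be read off the complete blocks of the prefix
of length [n].  The loss of 20 is the incomplete last block. *)
Lemma num_power_free_ge n :
  exists2 z, n <= 63 * z + 20 &
    2 ^ z <= num_binary_plus_power_free (7 / 3)%R n.
Proof.
have [t [t3 sf hz]] := squarefree_many_zeros (n %/ 21).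
set m := n %/ 21 in hz *; set Z := [set i : 'I_m | t i == 0] in hz.
exists #|Z|; first by rewrite /m in hz *; lia.
pose w (S : {set 'I_m}) := recolour t (fun i => i \in [seq val j | j in S]).
have w4 S i : w S i < 4.
  by rewrite /w /recolour; case: ifP => // _; apply: ltnW; apply: t3.
have wmod S : squarefree (fun i => w S i %% 3).
  have e i : w S i %% 3 = t i.
    by rewrite /w /recolour; case: ifP => [/andP[/eqP->]|_] //; rewrite modn_small.
  by move=> p i p0 rn; apply: (sf p i p0) => j hj; have := rn j hj; rewrite !e.
pose f S : n.-tuple bool := [tuple of mkseq (block_image (w S)) n].
have finj : {in powerset Z &, injective f}.
  move=> S S'; rewrite !inE => /subsetP SZ /subsetP SZ' /(congr1 val) /= e.
  have ew (i : 'I_m) : w S i = w S' i.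
    apply: block_image_letter_inj => // j hj.
    have hn : 21 * i + j < n by have := ltn_ord i; rewrite /m; lia.
    by rewrite -(@nth_mkseq _ false _ n) // e nth_mkseq.
  have memw (A : {set 'I_m}) (i : 'I_m) : A \subset Z -> (i \in A) = (w A i == 3).
    move=> /subsetP AZ; rewrite /w /recolour (mem_image val_inj).
    case: (boolP (i \in A)) => [/AZ|_]; first by rewrite inE => ->.
    by rewrite andbF; have := t3 i; case: eqP => // ->.
  by apply/setP => i; rewrite !memw ?ew //; apply/subsetP.
rewrite -card_powerset -(card_in_imset finj) /num_binary_plus_power_free.
apply: subset_leq_card; apply/subsetP => _ /imsetP[S _ ->]; rewrite inE.
apply/asboolP; apply: plus_power_free_of_no_run => p i k p0 hk.
exact: block_image_no_run.
Qed.

Local Open Scope ring_scope.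

Lemma root63_two_approx (R : realType) (g : R) :
  0 <= g -> g ^+ 63 = 2 -> `|g - 1011 / 1000| <= 1 / 2000.
Proof.
move=> g0 g63.
(* the two endpoints are [1011 / 1000 -+ 1 / 2000]; compare 63rd powers with 2 *)
have lo : 2021 / 2000 <= g.
  rewrite leNgt; apply/negP => h.
  have : g ^+ 63 <= (2021 / 2000) ^+ 63 by apply: lerXn2r; rewrite ?nnegrE; lra.
  by rewrite g63; lra.
have hi : g <= 2023 / 2000.
  rewrite leNgt; apply/negP => h.
  have : (2023 / 2000) ^+ 63 <= g ^+ 63 by apply: lerXn2r; rewrite ?nnegrE; lra.
  by rewrite g63; lra.
by rewrite ler_norml; lra.
Qed.

Theorem theorem11 (R : realType) (gamma : R) (hgamma : gamma = 2 `^ (1 / 63)) :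
  (exists2 c : R, 0 < c &
     exists N : nat, forall n : nat, (N <= n)%N ->
       c * gamma ^+ n <= (num_binary_plus_power_free (7 / 3) n)%:R)
  /\ `|gamma - 1011 / 1000| <= 1 / 2000.
Proof.
have g0 : 0 <= gamma by rewrite hgamma powR_ge0.
have g63 : gamma ^+ 63 = 2.
  by rewrite -powR_mulrn // hgamma -powRrM divfK ?powRr1 // pnatr_eq0.
have g1 : 1 <= gamma.
  by rewrite hgamma -[leLHS](powRr0 2); apply: ler_powR; lra.
split; last exact: root63_two_approx.
exists (1 / 2); first lra.
exists 0%N => n _; have [z nz hz] := num_power_free_ge n.
apply: (@le_trans _ _ (2 ^ z)%:R); last by rewrite ler_nat.
(* [n <= 63 z + 20] is weakened to [63 z + 63]: one further factor 2 = [gamma ^+ 63],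
   which the constant [1 / 2] absorbs *)
have : gamma ^+ n <= gamma ^+ (63 * z + 63) by apply: ler_weXn2l => //; lia.
by rewrite exprD exprM !g63 natrX; lra.
Qed.
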